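(* Fix $h,\ell\in\{1,\dots,n\}$ with $h\ne\ell$, and keep all graph weights other than $w_{h\ell}=w_{\ell h}$ fixed. For $\omega\ge0$ let $\lambda_0(\omega)$ denote the largest (Frobenius) eigenvalue of $L+A$ when $w_{h\ell}=w_{\ell h}=\omega$. Then the map $\omega\mapsto\lambda_0(\omega)$ is decreasing, in the weak sense (non-increasing), on $[0,+\infty)$.
   Context: Here $n\ge2$, $A=\mathrm{diag}(A_1,\dots,A_n)$ with $A_i>0$, $W=(w_{ij})$ is a symmetric $n\times n$ matrix of graph weights with $w_{ij}\ge0$, $w_{ii}=0$, and $L=(\ell_{ij})$ is the symmetric matrix given by $\ell_{ij}=w_{ij}$ for $i\neq j$ and $\ell_{ii}=-\sum_{j\ne i}w_{ij}$. *)

(* Defs.v *)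
From HB Require Import structures.
From mathcomp Require Import all_boot all_order all_algebra.
From mathcomp Require Import spectral complex.
From mathcomp Require Import classical_sets reals.

Set Implicit Arguments.
Unset Strict Implicit.
Unset Printing Implicit Defensive.

Import Order.TTheory GRing.Theory Num.Theory.

Local Open Scope ring_scope.

Definition graph_laplacian (R : realType) (n : nat) (W : 'M[R]_n) : 'M[R]_n :=
  \matrix_(i, j) if i == j then - \sum_(k | k != i) W i k else W i j.

Definition set_weight (R : realType) (n : nat) (W : 'M[R]_n) (h l : 'I_n)
    (omega : R) : 'M[R]_n :=
  \matrix_(i, j)
    if ((i == h) && (j == l)) || ((i == l) && (j == h)) then omega else W i j.

Definition is_largest_eigenvalue (R : realType) (n : nat) (M : 'M[R]_n)
    (a : R) : Prop :=
  eigenvalue M a /\ forall b : R, eigenvalue M b -> b <= a.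

(* The default value 0 is returned only when M has no real eigenvalue; the
   lemma below excludes this for symmetric M. *)
Definition largest_eigenvalue (R : realType) (n : nat) (M : 'M[R]_n) : R :=
  xget 0 [set a | is_largest_eigenvalue M a]%classic.

Lemma largest_eigenvalueP (R : realType) (n : nat) (M : 'M[R]_n) :
  (0 < n)%N -> M^T = M -> is_largest_eigenvalue M (largest_eigenvalue M).
Proof.
move=> n_gt0 Msym.
apply: (@xgetPex _ 0 [set a | is_largest_eigenvalue M a]%classic).
pose A : 'M[R[i]]_n := map_mx (real_complex R) M.
have Aherm : A \is hermsymmx.
  apply: realsym_hermsym.
    apply/is_hermitianmxP; rewrite expr0 scale1r map_mx_id //.
    by rewrite /A map_trmx Msym.
  by apply/mxOverP => i j; rewrite mxE; apply/complex_realP; exists (M i j).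
have /orthomx_spectralP := hermitian_normalmx Aherm.
set P := spectralmx A; set d := spectral_diag A => defA.
have Punit : P \in unitmx by apply: spectral_unit.
have dE i : d 0 i = real_complex R (complex.Re (d 0 i)).
  by rewrite RRe_real //; apply: (mxOverP (hermitian_spectral_diag_real Aherm)).
have PA : P *m A = diag_mx d *m P by rewrite {1}defA !mulmxA mulmxV // mul1mx.
have eig_d i : eigenvalue M (complex.Re (d 0 i)).
  rewrite -(eigenvalue_map (real_complex R)) -[X in eigenvalue _ X]dE; apply/eigenvalueP.
  exists (row i P).
    by rewrite -row_mul PA row_mul row_diag_mx -scalemxAl -rowE.
  apply/negP => /eqP Pi0.
  have := congr1 (fun u => (u *m invmx P) 0 i) Pi0.
  rewrite /= -row_mul mulmxV // mul0mx !mxE eqxx => /eqP.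
  by rewrite oner_eq0.
pose i0 : 'I_n := Ordinal n_gt0.
exists (complex.Re (d 0 [arg max_(i > i0) complex.Re (d 0 i)]%O)).
split=> // b; rewrite -(eigenvalue_map (real_complex R)).
case/eigenvalueP=> v vA v0.
pose u := v *m invmx P.
have uD : u *m diag_mx d = real_complex R b *: u.
  by rewrite /u scalemxAl -vA -/A [in RHS]defA !mulmxA mulmxK.
have /rV0Pn [j uj] : u != 0.
  apply: contraNneq v0 => u0.
  by rewrite -(mulmxKV Punit v) -/u u0 mul0mx.
have /matrixP/(_ 0 j) := uD.
rewrite mul_mx_diag mxE [RHS]mxE mulrC => /(mulIf uj) dj.
have -> : b = complex.Re (d 0 j) by rewrite dj.
by case: arg_maxP => // i _; apply.
Qed.

(* Main.v *)
(* The quadratic form of L is v L v^T = - 1/2 sum_ij w_ij (v_i - v_j)^2, which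
   decreases when a weight increases.  Evaluating the form of L + A at an
   eigenvector for lambda_0(omega2) and bounding the form at omega1 by
   lambda_0(omega1) |v|^2 (Rayleigh) gives lambda_0(omega2) <= lambda_0(omega1).
   The Rayleigh bound follows by diagonalizing over R[i]. *)

Require Import Defs.
From mathcomp Require Import all_boot all_order all_algebra.
From mathcomp Require Import reals.
From mathcomp Require Import spectral complex.
From mathcomp Require Import ring.

Import Order.TTheory GRing.Theory Num.Theory.

Local Open Scope ring_scope.
Local Open Scope sesquilinear_scope.

Lemma quadratic_formE (R : comPzRingType) (n : nat) (M : 'M[R]_n) (v : 'rV[R]_n) :
  (v *m M *m v^T) 0 0 = \sum_i \sum_j M i j * (v 0 i * v 0 j).
Proof.
rewrite mxE exchange_big; apply: eq_bigr => j _.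
rewrite !mxE mulr_suml; apply: eq_bigr => i _.
by rewrite mulrCA mulrA mulrC mulrA mulrAC.
Qed.

Lemma graph_laplacian_formE (R : realType) (n : nat) (W : 'M[R]_n)
    (v : 'rV[R]_n) :
  W^T = W ->
  (v *m graph_laplacian W *m v^T) 0 0 *+ 2 =
    - \sum_i \sum_j W i j * (v 0 i - v 0 j) ^+ 2.
Proof.
move=> Wsym.
(* The diagonal entry [- \sum_(k | k != i) W i k] contributes one [- v_i^2] to each off-diagonal
   term of row [i]; the term [j = i] vanishes since its factor is [v_i - v_i]. *)
have -> : (v *m graph_laplacian W *m v^T) 0 0 =
    \sum_i \sum_j W i j * (v 0 i * (v 0 j - v 0 i)).
  rewrite quadratic_formE; apply: eq_bigr => i _.
  rewrite (bigD1 i) //= [RHS](bigD1 i) //= subrr !mulr0 add0r mxE eqxx mulNr.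
  rewrite mulr_suml -sumrN -big_split /=; apply: eq_bigr => j ji.
  by rewrite mxE eq_sym (negbTE ji) -mulrN -mulrDr mulrBr addrC.
(* Swapping [i] and [j] in one of the two copies and using the symmetry of [W], the paired terms
   [v_i (v_j - v_i) + v_j (v_i - v_j)] add up to [- (v_i - v_j)^2]. *)
rewrite mulr2n {2}exchange_big -big_split -sumrN; apply: eq_bigr => i _ /=.
rewrite -big_split -sumrN; apply: eq_bigr => j _ /=.
by rewrite -{2}Wsym mxE; ring.
Qed.

Lemma ler_graph_laplacian_form (R : realType) (n : nat) (V W : 'M[R]_n)
    (v : 'rV[R]_n) :
  V^T = V -> W^T = W -> (forall i j, V i j <= W i j) ->
  (v *m graph_laplacian W *m v^T) 0 0 <= (v *m graph_laplacian V *m v^T) 0 0.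
Proof.
move=> Vsym Wsym VW.
rewrite -(ler_pMn2r (n := 2)) // !graph_laplacian_formE // lerN2.
apply: ler_sum => i _; apply: ler_sum => j _.
by rewrite ler_wpM2r // sqr_ge0.
Qed.

Lemma tr_graph_laplacian (R : realType) (n : nat) (W : 'M[R]_n) :
  W^T = W -> (graph_laplacian W)^T = graph_laplacian W.
Proof.
move=> Wsym; apply/matrixP=> i j; rewrite !mxE eq_sym.
by case: eqVneq => [-> //|_]; rewrite -{1}Wsym mxE.
Qed.

Lemma tr_set_weight (R : realType) (n : nat) (W : 'M[R]_n) (h l : 'I_n)
    (omega : R) :
  W^T = W -> (set_weight W h l omega)^T = set_weight W h l omega.
Proof.
move=> Wsym; apply/matrixP=> i j; rewrite !mxE -{1}Wsym mxE.
by rewrite orbC (andbC (j == l)) (andbC (j == h)).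
Qed.

(** In the coordinates [u] of [v] in a unitary eigenbasis, the form is a sum of [d_i |u_i|^2] and
    the squared norm is the sum of [|u_i|^2], where every [d_i] is an eigenvalue of [M]. *)
Lemma rayleigh_le (R : realType) (n : nat) (M : 'M[R]_n) (a : R)
    (v : 'rV[R]_n) :
  M^T = M -> (forall b, eigenvalue M b -> b <= a) ->
  (v *m M *m v^T) 0 0 <= a * (v *m v^T) 0 0.
Proof.
move=> Msym le_a.
pose B : 'M[R[i]]_n := map_mx (real_complex R) M.
pose z : 'rV[R[i]]_n := map_mx (real_complex R) v.
have Bherm : B \is hermsymmx.
  apply: realsym_hermsym.
    apply/is_hermitianmxP; rewrite expr0 scale1r map_mx_id //.
    by rewrite map_trmx Msym.
  by apply/mxOverP => i j; rewrite mxE; apply/complex_realP; exists (M i j).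
have /orthomx_spectralP := hermitian_normalmx Bherm.
set P := spectralmx B; set d := spectral_diag B => defB.
have Pun : P \is unitarymx by apply: spectral_unitarymx.
have Punit : P \in unitmx by apply: spectral_unit.
have dE i : d 0 i = real_complex R (complex.Re (d 0 i)).
  by rewrite RRe_real //; apply: (mxOverP (hermitian_spectral_diag_real Bherm)).
have PB : P *m B = diag_mx d *m P by rewrite {1}defB !mulmxA mulmxV // mul1mx.
have d_le i : complex.Re (d 0 i) <= a.
  apply: le_a; rewrite -(eigenvalue_map (real_complex R)) -[X in eigenvalue _ X]dE.
  (* Row [i] of [P] is a left eigenvector for [d_i]; it is nonzero because multiplying it by the
     inverse of [P] gives a row of the identity. *)
  apply/eigenvalueP; exists (row i P).
    by rewrite -row_mul PB row_mul row_diag_mx -scalemxAl -rowE.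
  apply/negP => /eqP /(congr1 (fun u => (u *m invmx P) 0 i)) /=.
  by rewrite -row_mul mulmxV // mul0mx !mxE eqxx => /eqP; rewrite oner_eq0.
(* As [z] has real entries, the Hermitian form at [z] is the real form at [v]. *)
have ztE : z^t* = map_mx (real_complex R) v^T.
  apply/matrixP=> i j; rewrite !mxE.
  by apply/conj_Creal/complex_realP; exists (v j i).
pose u := z *m invmx P.
have utE : u^t* = P *m z^t*.
  by rewrite /u invmx_unitary // trmx_mul map_mxM trmxCK.
rewrite -(lecR (R := R)).
have form (N : 'M[R]_n) : real_complex R ((v *m N *m v^T) 0 0) =
    (z *m map_mx (real_complex R) N *m z^t*) 0 0.
  by rewrite ztE -!map_mxM [RHS]mxE.
rewrite [X in X <= _]form -/B defB.
have -> : z *m (invmx P *m diag_mx d *m P) *m z^t* = u *m diag_mx d *m u^t*.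
  by rewrite utE /u !mulmxA.
have -> : real_complex R (a * (v *m v^T) 0 0) = real_complex R a * (u *m u^t*) 0 0.
  by rewrite utE /u mulmxA mulmxKV // rmorphM /= ztE -map_mxM [in RHS]mxE.
rewrite mul_mx_diag !mxE mulr_sumr; apply: ler_sum => i _.
rewrite !mxE mulrAC mulrC.
by rewrite ler_wpM2r ?mul_conjC_ge0 // dE lecR.
Qed.

Theorem proposition5p13 (R : realType) (n : nat) (A : 'rV[R]_n) (W : 'M[R]_n)
    (h l : 'I_n)
    (hn : (2 <= n)%N)
    (A_gt0 : forall i : 'I_n, 0 < A 0 i)
    (W_sym : W^T = W)
    (W_ge0 : forall i j : 'I_n, 0 <= W i j)
    (W_diag0 : forall i : 'I_n, W i i = 0)
    (hl : h != l) :
  let lambda0 (omega : R) :=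
    largest_eigenvalue (graph_laplacian (set_weight W h l omega) + diag_mx A) in
  forall omega1 omega2 : R,
    0 <= omega1 -> omega1 <= omega2 -> lambda0 omega2 <= lambda0 omega1.
Proof.
move=> lambda0 omega1 omega2 _ le_omega.
pose M (omega : R) := graph_laplacian (set_weight W h l omega) + diag_mx A.
have Msym omega : (M omega)^T = M omega.
  by rewrite /M linearD /= tr_diag_mx tr_graph_laplacian ?tr_set_weight.
have largestP omega : is_largest_eigenvalue (M omega) (lambda0 omega).
  by apply: largest_eigenvalueP; rewrite // (leq_trans _ hn).
have [/eigenvalueP[v vM v_neq0] _] := largestP omega2.
have [_ /(rayleigh_le _ _ _ _ v (Msym omega1)) rayleigh] := largestP omega1.
(* Positivity allows cancelling the squared norm of the eigenvector. *)
have vv_gt0 : 0 < (v *m v^T) 0 0.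
  have [i vi] := rV0Pn _ v_neq0.
  rewrite mxE (bigD1 i) //= mxE -expr2 ltr_wpDr ?exprn_even_gt0 //.
  by apply: sumr_ge0 => j _; rewrite mxE -expr2 sqr_ge0.
rewrite -(ler_pM2r vv_gt0) (le_trans _ rayleigh) //.
have -> : lambda0 omega2 * (v *m v^T) 0 0 = (v *m M omega2 *m v^T) 0 0.
  by rewrite vM -scalemxAl [RHS]mxE.
(* The form of [diag_mx A] is common to both sides and cancels; the weights left to compare differ
   only at [(h, l)] and [(l, h)]. *)
rewrite /M !mulmxDr !mulmxDl mxE [leRHS]mxE lerD2r.
apply: ler_graph_laplacian_form; rewrite ?tr_set_weight // => i j.
by rewrite !mxE; case: ifP.
Qed.
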